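(* Let $(S,\mathcal{A},\mu)$ be a complete $\sigma$-finite measure space, let $E$ be a Köthe function space over $(S,\mathcal{A},\mu)$ and let $X$ be a Banach space such that the simple functions are dense in $E(X)$. If $X$ has the weak-DD2P, then $E(X)$ also has the weak-DD2P.
   Context: A Köthe function space over a complete $\sigma$-finite measure space $(S,\mathcal{A},\mu)$ is a Banach space $(E,\|\cdot\|_E)$ of real-valued measurable functions, identified up to equality $\mu$-a.e., such that: (1) $\chi_A\in E$ for every $A\in\mathcal{A}$ with $\mu(A)<\infty$; (2) every $f\in E$ is $\mu$-integrable over each $A\in\mathcal{A}$ with $\mu(A)<\infty$; (3) if $f\in E$ and $g$ is measurable with $|g(t)|\leq|f(t)|$ $\mu$-a.e., then $g\in E$ and $\|g\|_E\leq\|f\|_E$. A function $f\colon S\to X$ is simple if there are finitely many pairwise disjoint sets $A_1,\dots,A_n\in\mathcal{A}$ of finite measure such that $f$ is constant on each $A_i$ and vanishes outside $\bigcup_i A_i$; it is Bochner measurable if there are simple functions $f_n$ with $\|f_n(t)-f(t)\|\to0$ $\mu$-a.e. The Köthe--Bochner space $E(X)$ is the Banach space of (classes of) Bochner measurable $f\colon S\to X$ such that $t\mapsto\|f(t)\|$ belongs to $E$, with norm $\|f\|_{E(X)}=\big\|\,\|f(\cdot)\|\,\big\|_E$. A Banach space $Z$ with closed unit ball $B_Z$ has the weak-DD2P (weak diametral diameter two property) if for every non-empty relatively weakly open subset $W$ of $B_Z$ there exists $z\in W$ such that $\sup_{y\in V}\|z-y\|=2$ for every relatively weakly open subset $V$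 of $B_Z$ with $z\in V$.
   Formalization: The measure space is additionally assumed to satisfy μ(S) > 0; if μ = 0 then E(X) = {0}, which fails the weak-DD2P although X may have it, so the statement as written is false in that case. *)

(* Defs.v *)
From HB Require Import structures.
From mathcomp Require Import all_boot all_order all_algebra ring_quotient finmap.
From mathcomp Require Import all_classical all_reals all_analysis.
From mathcomp Require Import measurable_realfun.
Set Implicit Arguments.
Unset Strict Implicit.
Unset Printing Implicit Defensive.
Import Order.TTheory GRing.Theory Num.Theory numFieldNormedType.Exports.
Local Open Scope classical_set_scope.
Local Open Scope ring_scope.

Definition topological_dual (R : realType) (Z : normedModType R) : Type :=
  {phi : {linear Z -> R^o} | continuous (phi : Z -> R^o)}.

Definition weak_space (R : realType) (Z : normedModType R) : Type :=
  sup_topology (fun phi : topological_dual Z =>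
    Topological.class (initial_topology (sval phi : Z -> R^o))).

HB.instance Definition _ (R : realType) (Z : normedModType R) :=
  Topological.on (weak_space Z).

Definition weakly_open (R : realType) (Z : normedModType R) (U : set Z) :=
  open (U : set (weak_space Z)).

Definition unit_ball (R : realType) (Z : normedModType R) : set Z :=
  [set z | `|z| <= 1].
Arguments unit_ball {R} Z _.

Definition rel_weakly_open (R : realType) (Z : normedModType R) (W : set Z) :=
  exists2 U : set Z, weakly_open U & W = U `&` unit_ball Z.

(* The supremum is taken in [R]: the set is nonempty (it contains [`|z - z|])
   and bounded by 2, so the junk value of [sup] never occurs. *)
Definition weakDD2P (R : realType) (Z : normedModType R) :=
  forall W : set Z, rel_weakly_open W -> W !=set0 ->
    exists2 z, W z & forall V : set Z, rel_weakly_open V -> V z ->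
      sup [set `|z - y| | y in V] = 2.

Section bochner_measurable.
Context d (S : measurableType d) (R : realType).
Variable mu : {measure set S -> \bar R}.

Definition simple_fun (X : zmodType) (f : S -> X) :=
  exists n (A : 'I_n -> set S),
    [/\ forall i, measurable (A i) /\ (mu (A i) < +oo)%E,
        trivIset setT A,
        forall i, exists c, forall t, A i t -> f t = c &
        forall t, ~ (\bigcup_i A i) t -> f t = 0].

Definition bochner_measurable (X : normedModType R) (f : S -> X) :=
  exists2 s : nat -> S -> X, forall n, simple_fun (s n) &
    \forall t \ae mu, `|s n t - f t| @[n --> \oo] --> (0 : R).

Lemma simple_preimage (X : zmodType) (f : S -> X) : simple_fun f ->
  forall B : set X, measurable (f @^-1` B).
Proof.
move=> [n [A [mA _ /choice[c fc] f0]]] B.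
have mU (P : set 'I_n) : measurable (\bigcup_(i in P) A i).
  by apply: fin_bigcup_measurable => // i _; case: (mA i).
have -> : f @^-1` B = (\bigcup_(i in c @^-1` B) A i) `|`
    (if 0 \in B then ~` \bigcup_i A i else set0).
  apply/seteqP; split => t /=.
    move=> Bft; have [[i _ At]|NU] := pselect ((\bigcup_i A i) t).
      by left; exists i => //=; rewrite -(fc i t).
    right; rewrite -(f0 _ NU).
    by rewrite mem_set.
  case=> [[i /= Bc At]|]; first by rewrite (fc i).
  by case: ifPn => // /set_mem B0 /f0 ->.
by apply: measurableU => //; case: ifP => // _; exact: measurableC.
Qed.

Lemma simpleP (X : zmodType) (f : S -> X) : simple_fun f <->
  [/\ finite_set (range f), forall B : set X, measurable (f @^-1` B) &
      (mu (f @^-1` [set~ 0%R]) < +oo)%E].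
Proof.
split=> [sf|[ffin mf fmu]].
  split; [|exact: simple_preimage|]; last first.
  - have [n [A [mA tA _ f0]]] := sf.
    have mU : measurable (\bigcup_i A i).
      by apply: fin_bigcup_measurable => // i _; case: (mA i).
    apply: (@le_lt_trans _ _ (mu (\bigcup_i A i))).
      apply: le_measure; rewrite ?inE//; first exact: simple_preimage.
      by move=> t /= ft; apply: contrapT => /f0.
    have fI : finite_set [set: 'I_n] by exact: finite_finset.
    rewrite measure_fin_bigcup//; last by move=> i _; case: (mA i).
    rewrite fsbig_finite//=; apply: lte_sum_pinfty => i _.
    by case: (mA i).
  - have [n [A [_ _ /choice[c fc] f0]]] := sf.
    apply: (@sub_finite_set _ _ (0 |` range c)).
      move=> _ [t _ <-].
      have [[i _ At]|NU] := pselect ((\bigcup_i A i) t).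
        by right; exists i => //; rewrite -(fc i t).
      by left; exact: f0.
    by rewrite finite_setU; split => //; exact: finite_image.
pose s := [seq x <- enum_fset (fset_set (range f)) | x != 0].
exists (size s), (fun i => f @^-1` [set s`_i]).
have s0 (i : 'I_(size s)) : s`_i != 0.
  have /(mem_nth 0) : (i < size s)%N by [].
  by rewrite mem_filter => /andP[].
split.
- move=> i; split => //; apply: le_lt_trans fmu; apply: le_measure;
    rewrite ?inE//.
  by move=> t /= ->; apply/eqP.
- move=> i j _ _ [t [/= -> /eqP]].
  rewrite nth_uniq// ?filter_uniq ?fset_uniq//; by move/eqP/val_inj.
- by move=> i; exists s`_i.
- move=> t Nt; apply: contrapT => /eqP ft0; apply: Nt.
  have fts : f t \in s.
    by rewrite mem_filter ft0/= in_fset_set//; apply/mem_set; exists t.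
  have ilt : (index (f t) s < size s)%N by rewrite index_mem.
  by exists (Ordinal ilt) => //=; rewrite nth_index.
Qed.

Lemma simple_comp2 (X Y Z : zmodType) (h : X -> Y -> Z) (f : S -> X)
  (g : S -> Y) : h 0 0 = 0 -> simple_fun f -> simple_fun g ->
  simple_fun (fun t => h (f t) (g t)).
Proof.
move=> h0 /simpleP[ff mf fmu] /simpleP[gf mg gmu]; apply/simpleP.
have mh (B : set Z) : measurable ((fun t => h (f t) (g t)) @^-1` B).
  pose D := (range f `*` range g) `&` [set p | B (h p.1 p.2)].
  rewrite (_ : _ @^-1` _ =
    \bigcup_(p in D) (f @^-1` [set p.1] `&` g @^-1` [set p.2])).
    apply: fin_bigcup_measurable.
      by apply: sub_finite_set (finite_setX ff gf); exact: subIsetl.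
    by move=> p _; exact: measurableI.
  apply/seteqP; split => t /=.
    move=> Bt; exists (f t, g t); last by split.
    by split; [split; exists t|].
  by move=> [[a b] [_ /= Bab] [/= -> ->]].
split => //; first exact: finite_image11.
have mfg : measurable (f @^-1` [set~ 0%R] `|` g @^-1` [set~ 0%R]).
  exact: measurableU.
apply: (@le_lt_trans _ _ (mu (f @^-1` [set~ 0%R] `|` g @^-1` [set~ 0%R]))).
  apply: le_measure; rewrite ?inE// => t /= hfg.
  apply: contrapT => /not_orP[/contrapT f0 /contrapT g0].
  by apply: hfg; rewrite f0 g0.
apply: le_lt_trans (measureU2 _ (mf _) (mg _)) _.
exact: lte_add_pinfty.
Qed.

Lemma simple0 (X : zmodType) : simple_fun (0 : S -> X).
Proof.
by exists 0%N, (fun=> set0); split => // -[].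
Qed.

Lemma bochner_measurable0 (X : normedModType R) :
  bochner_measurable (0 : S -> X).
Proof.
exists (fun=> 0); first by move=> _; exact: simple0.
apply: aeW => t.
under eq_fun do rewrite subrr normr0.
exact: cvg_cst.
Qed.

Lemma bochner_measurable_lin (X : normedModType R) (a : R) (f g : S -> X) :
  bochner_measurable f -> bochner_measurable g ->
  bochner_measurable (a *: f + g).
Proof.
move=> [s ss sf] [r sr rg].
exists (fun n t => a *: s n t + r n t).
  move=> n; apply: (@simple_comp2 _ _ _ (fun x y => a *: x + y)) => //.
  by rewrite scaler0 addr0.
apply: filterS2 sf rg => t sft rgt.
apply: (@squeeze_cvgr _ _ _ _ (fun=> 0) (fun n => `|a| * `|s n t - f t| +
   `|r n t - g t|)).
- apply: nearW => n; rewrite normr_ge0/=.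
  rewrite (_ : _ - _ = a *: (s n t - f t) + (r n t - g t)).
    by rewrite (le_trans (ler_normD _ _))// normrZ.
  by rewrite scalerBr addrACA opprD.
- exact: cvg_cst.
- rewrite -[X in _ --> X](_ : `|a| * 0 + 0 = 0 :> R); last first.
    by rewrite mulr0 addr0.
  by apply: cvgD => //; apply: cvgM => //; exact: cvg_cst.
Qed.

Lemma bochner_measurable_norm (X : normedModType R) (f : S -> X) :
  measure_is_complete mu -> bochner_measurable f ->
  measurable_fun setT (fun t => `|f t|).
Proof.
move=> cmu [s ss [N [mN N0 sN]]].
pose h n t : R := `|s n t| * \1_(~` N) t.
pose hf t : R := `|f t| * \1_(~` N) t.
have mh n : measurable_fun setT (h n).
  apply: measurable_funM.
    have /simple_preimage ms : simple_fun (fun t => `|s n t|).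
      apply: (@simple_comp2 _ _ _ (fun x _ : X => `|x|) (s n) (s n)) => //.
      exact: normr0.
    by move=> _ B _; rewrite setTI; exact: ms.
  by apply: measurable_indic; exact: measurableC.
have mhf : measurable_fun setT hf.
  apply: (@measurable_fun_cvg _ _ _ _ h) => // t _.
  rewrite /h /hf indicE; have [tN|tN] := boolP (t \in ~` N); last first.
    by rewrite mulr0; under eq_fun do rewrite mulr0; exact: cvg_cst.
  rewrite mulr1; under eq_fun do rewrite mulr1.
  apply: cvg_norm.
  have st : `|s n t - f t| @[n --> \oo] --> (0 : R).
    by apply: contrapT => Nst; move/set_mem: tN; apply; exact: sN.
  by apply/subr_cvg0; exact: norm_cvg0.
suff /measurable_EFinP : measurable_fun setT (EFin \o (fun t => `|f t|)) by [].
apply: (ae_measurable_fun cmu _ ((measurable_EFinP _ _).2 mhf)).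
exists N; split => // t /= /not_implyP[_ ht]; apply: contrapT => Nt; apply: ht.
by rewrite /= /hf indicE mem_set//= mulr1.
Qed.

End bochner_measurable.

(* Elements of a Koethe space are classes modulo mu-a.e. equality.  They are
   represented here by their representatives: [kothe_mem] is the set of
   functions whose class is in the space and [kothe_norm] (only meaningful on
   [kothe_mem]) is the norm of the class.  By [kothe_ideal] and completeness of
   mu, both are invariant under a.e. equality, and [kothe_norm_eq0] says that
   [kothe_norm] is a norm on the classes. *)
Record kothe_space d (S : measurableType d) (R : realType)
    (mu : {measure set S -> \bar R}) (cmu : measure_is_complete mu)
    (smu : sigma_finite [set: S] mu) := KotheSpace {
  kothe_mem : set (S -> R) ;
  kothe_norm : (S -> R) -> R ;
  kothe_measurable : forall f, kothe_mem f -> measurable_fun [set: S] f ;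
  kothe_mem0 : kothe_mem 0 ;
  kothe_memD : forall f g, kothe_mem f -> kothe_mem g -> kothe_mem (f + g) ;
  kothe_memZ : forall (a : R) f, kothe_mem f -> kothe_mem (a *: f) ;
  kothe_normD : forall f g, kothe_mem f -> kothe_mem g ->
    kothe_norm (f + g) <= kothe_norm f + kothe_norm g ;
  kothe_normZ : forall (a : R) f, kothe_mem f ->
    kothe_norm (a *: f) = `|a| * kothe_norm f ;
  kothe_norm_eq0 : forall f, kothe_mem f -> kothe_norm f = 0 ->
    f = 0 %[ae mu] ;
  kothe_complete : forall u : nat -> S -> R, (forall n, kothe_mem (u n)) ->
    (forall e : R, 0 < e -> exists N, forall m n, (N <= m)%N -> (N <= n)%N ->
       kothe_norm (u m - u n) < e) ->
    exists2 f, kothe_mem f & kothe_norm (u n - f) @[n --> \oo] --> (0 : R) ;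
  kothe_indic : forall A, measurable A -> (mu A < +oo)%E -> kothe_mem \1_A ;
  kothe_integrable : forall f A, kothe_mem f -> measurable A ->
    (mu A < +oo)%E -> mu.-integrable A (EFin \o f) ;
  kothe_ideal : forall f g : S -> R, kothe_mem f -> measurable_fun [set: S] g ->
    (\forall t \ae mu, `|g t| <= `|f t|) ->
    kothe_mem g /\ kothe_norm g <= kothe_norm f
}.

Section kothe_bochner.
Context d (S : measurableType d) (R : realType).
Context (mu : {measure set S -> \bar R}) (cmu : measure_is_complete mu).
Context (smu : sigma_finite [set: S] mu).
Variables (E : kothe_space cmu smu) (X : normedModType R).

Definition kb_pred : {pred S -> X} :=
  mem [set f | bochner_measurable mu f /\ kothe_mem E (fun t => `|f t|)].

Lemma kb_submod_closed : submod_closed kb_pred.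
Proof.
split.
  apply/mem_set; split; first exact: bochner_measurable0.
  rewrite [X in kothe_mem E X](_ : _ = 0); first exact: kothe_mem0.
  by apply/funext => t; rewrite normr0.
move=> a f g /set_mem[bf Ef] /set_mem[bg Eg]; apply/mem_set.
have bfg := bochner_measurable_lin a bf bg.
split=> //.
have EH : kothe_mem E (`|a| *: (fun t => `|f t|) + (fun t => `|g t|)).
  by apply: kothe_memD => //; exact: kothe_memZ.
apply: (kothe_ideal EH (bochner_measurable_norm cmu bfg) _).1.
apply: aeW => t; rewrite normr_id.
apply: le_trans (ler_norm _); apply: le_trans (ler_normD _ _) _.
by rewrite normrZ.
Qed.

HB.instance Definition _ :=
  GRing.isSubmodClosed.Build R (S -> X) kb_pred kb_submod_closed.

Definition kb_fun : Type := {f : S -> X | f \in kb_pred}.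
HB.instance Definition _ := SubChoice.on kb_fun.
HB.instance Definition _ := [SubChoice_isSubLmodule of kb_fun by <:].

Definition kb_null : {pred kb_fun} :=
  mem [set f : kb_fun | val f = 0 %[ae mu]].

Lemma kb_null_zmod_closed : zmod_closed kb_null.
Proof.
split; first by apply/mem_set; apply: aeW => t.
move=> f g /set_mem f0 /set_mem g0; apply/mem_set => /=.
apply: filterS2 f0 g0 => t /(_ I) ft /(_ I) gt _.
by rewrite -[LHS]/(val f t - val g t) ft gt subrr.
Qed.

HB.instance Definition _ :=
  GRing.isZmodClosed.Build kb_fun kb_null kb_null_zmod_closed.

(* The norm and the module structure of E(X) come from representatives, see
   [kb_norm_class], [kb_classD] and [kb_classZ]. *)
Definition kothe_bochner : Type := Quotient.quot kb_null.
HB.instance Definition _ := Choice.on kothe_bochner.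
HB.instance Definition _ := GRing.Zmodule.on kothe_bochner.

Definition kb_class (f : kb_fun) : kothe_bochner :=
  \pi_(Quotient.quot kb_null)%qT f.

Definition kb_repr (x : kothe_bochner) : kb_fun :=
  repr (x : Quotient.quot kb_null).

Lemma kb_reprK : cancel kb_repr kb_class.
Proof. by move=> x; exact: reprK. Qed.

Lemma kb_classP (f g : kb_fun) :
  kb_class f = kb_class g <-> val f = val g %[ae mu].
Proof.
rewrite /kb_class; split.
  move=> /eqP; rewrite -Quotient.idealrBE => /set_mem.
  apply: filterS => t /(_ I) fg _; apply/eqP; rewrite -subr_eq0.
  by apply/eqP; exact: fg.
move=> fg; apply/eqP; rewrite -Quotient.idealrBE; apply/mem_set => /=.
apply: filterS fg => t /(_ I) ft _.
by rewrite -[LHS]/(val f t - val g t) ft subrr.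
Qed.

Lemma kb_class_reprK f : val (kb_repr (kb_class f)) = val f %[ae mu].
Proof. by apply/kb_classP; rewrite kb_reprK. Qed.

Lemma kb_class0 : kb_class 0 = 0.
Proof. by rewrite /kb_class !piE. Qed.

Lemma kb_classD : {morph kb_class : f g / f + g}.
Proof. by move=> f g; rewrite /kb_class !piE. Qed.

Definition kb_scale (a : R) (x : kothe_bochner) : kothe_bochner :=
  kb_class (a *: kb_repr x).

Lemma kb_classZ a f : kb_class (a *: f) = kb_scale a (kb_class f).
Proof.
apply/kb_classP; apply: filterS (kb_class_reprK f) => t /(_ I) ft _.
by rewrite -[LHS]/(a *: val f t) -[RHS]/(a *: val (kb_repr (kb_class f)) t) ft.
Qed.

Fact kb_scaleA a b x : kb_scale a (kb_scale b x) = kb_scale (a * b) x.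
Proof. by rewrite -[x]kb_reprK -!kb_classZ scalerA. Qed.

Fact kb_scale1 : left_id 1 kb_scale.
Proof. by move=> x; rewrite -[x in LHS]kb_reprK -kb_classZ scale1r kb_reprK. Qed.

Fact kb_scaleDr : right_distributive kb_scale +%R.
Proof.
move=> a x y; rewrite -[x]kb_reprK -[y]kb_reprK.
by rewrite -kb_classD -!kb_classZ scalerDr kb_classD.
Qed.

Fact kb_scaleDl x : {morph kb_scale^~ x : a b / a + b}.
Proof.
by move=> a b; rewrite -[x]kb_reprK -!kb_classZ scalerDl kb_classD.
Qed.

HB.instance Definition _ := GRing.Zmodule_isLmodule.Build R kothe_bochner
  kb_scaleA kb_scale1 kb_scaleDr kb_scaleDl.

Definition kb_norm (x : kothe_bochner) : R :=
  kothe_norm E (fun t => `|val (kb_repr x) t|).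

Lemma kb_fun_mem (f : kb_fun) : kothe_mem E (fun t => `|val f t|).
Proof. by have /set_mem[] := valP f. Qed.

Lemma kb_norm_class f : kb_norm (kb_class f) = kothe_norm E (fun t => `|val f t|).
Proof.
have fE := kb_class_reprK f.
apply/eqP; rewrite eq_le; apply/andP; split.
  apply: (kothe_ideal (kb_fun_mem f) _ _).2.
    exact: kothe_measurable (kb_fun_mem _).
  by apply: filterS fE => t /(_ I) ->.
apply: (kothe_ideal (kb_fun_mem _) _ _).2.
  exact: kothe_measurable (kb_fun_mem _).
by apply: filterS fE => t /(_ I) ->.
Qed.

Fact kb_ler_normD x y : kb_norm (x + y) <= kb_norm x + kb_norm y.
Proof.
rewrite -[x]kb_reprK -[y]kb_reprK -kb_classD !kb_norm_class.
apply: le_trans (kothe_normD (kb_fun_mem _) (kb_fun_mem _)).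
have EH := kothe_memD (kb_fun_mem (kb_repr x)) (kb_fun_mem (kb_repr y)).
apply: (kothe_ideal EH _ _).2; first exact: kothe_measurable (kb_fun_mem _).
apply: aeW => t; rewrite normr_id.
by apply: le_trans (ler_norm _); exact: ler_normD.
Qed.

Fact kb_normrZ a x : kb_norm (a *: x) = `|a| * kb_norm x.
Proof.
rewrite -[x]kb_reprK -[_ *: _]kb_classZ !kb_norm_class.
rewrite -(normr_id a) -kothe_normZ; last exact: kb_fun_mem.
by congr kothe_norm; apply/funext => t; exact: normrZ.
Qed.

Fact kb_normr0_eq0 x : kb_norm x = 0 -> x = 0.
Proof.
rewrite -[x]kb_reprK kb_norm_class => /(kothe_norm_eq0 (kb_fun_mem _)) x0.
rewrite -kb_class0; apply/kb_classP.
by apply: filterS x0 => t /(_ I) /normr0_eq0 ->.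
Qed.

HB.instance Definition _ := Lmodule_isNormed.Build R kothe_bochner
  kb_ler_normD kb_normrZ kb_normr0_eq0.

Definition kb_simple : set kothe_bochner :=
  [set x | exists2 f : kb_fun, simple_fun mu (val f) & x = kb_class f].

End kothe_bochner.
Arguments kb_simple {d S R mu cmu smu} E X _.

(* Main.v *)
From HB Require Import structures.
Require Import Defs.
From mathcomp Require Import all_boot all_order all_algebra.
From mathcomp Require Import lra.
From mathcomp Require Import all_classical all_reals all_analysis.
Set Implicit Arguments.
Unset Strict Implicit.
Unset Printing Implicit Defensive.
Import Order.TTheory GRing.Theory Num.Theory numFieldNormedType.Exports.
Local Open Scope classical_set_scope.
Local Open Scope ring_scope.

(** Call a point [z] of the unit ball of a normed space diametral if, for every
    [e > 0], it is a weak limit of points [y] of the ball with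
    [2 - e < `|z - y|]; then [`|z| = 1].  The weak-DD2P says exactly that the
    diametral points are weakly dense in the unit ball ([weakDD2PP]).

    Let [X] have the weak-DD2P and consider vectors [sum_i T_i x_i] of a
    normed space [Z <> 0], where the [T_i : X -> Z] are finitely many continuous
    linear maps such that the norm of [sum_i T_i x_i] increases with the norms [`|x_i|].
    Suppose such vectors are dense in [Z].  A nonempty relatively weakly open
    subset of the ball, given by a weakly open [U], then contains some
    [f = sum_i T_i x_i] with [0 < `|f| <= 1].  The norm of [f] may be less than
    1, while a diametral point has norm 1, so the norm has to be raised without
    leaving [U].  Put [r_i = `|x_i| / `|f|], so that [x_i] is [r_i] times a point
    of the unit ball of [X].  Each of these points is a weak limit of diametral
    points of [X], hence some [z = sum_i T_i (r_i z_i)] with all [z_i] diametral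
    still lies in [U].  Now [r_i z_i] has norm [`|x_i| / `|f|], so by
    monotonicity [z] has the norm of [f / `|f|], that is 1.

    This [z] is diametral.  Approximate each [z_i] weakly by [y_i] in the ball
    with [2 - e < `|z_i - y_i|] and let [y = sum_i T_i (r_i y_i)].  Monotonicity
    gives [`|y| <= `|z| = 1] and [`|z - y| >= (2 - e) `|z| = 2 - e].  This is
    [weakDD2P_dense_monotone].

    In [E(X)] the maps [x |-> \1_A x], for pairwise disjoint sets [A] of finite
    measure, form such a family: the norm of a simple function is the norm in
    [E] of its pointwise norm, and [E] is an ideal ([indic_embed_monotone]).
    The sums [sum_i T_i x_i] are then the simple functions.  As
    the measure is sigma-finite and positive, some [A] has finite positive
    measure, so that [E(X)] is not 0. *)

(** * The weak topology *)

Lemma continuous_to_weak (R : realType) (T : topologicalType)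
    (Z : normedModType R) (g : T -> Z) :
  (forall phi : topological_dual Z, continuous (sval phi \o g : T -> R^o)) ->
  continuous (g : T -> weak_space Z).
Proof.
move=> gphi x; apply/cvg_sup => phi A /=.
move=> [_ [[B Bop <-] Bgx] sBA].
apply: filterS sBA _.
by apply: (gphi phi x); exact: open_nbhs_nbhs.
Qed.

Lemma dual_weak_continuous (R : realType) (Z : normedModType R)
    (phi : topological_dual Z) : continuous (sval phi : weak_space Z -> R^o).
Proof.
move=> x.
have /cvg_sup /(_ phi) idx : (nbhs (x : weak_space Z)) --> (x : weak_space Z).
  by [].
apply: cvg_trans (@initial_continuous _ _ (sval phi : Z -> R^o) x).
exact: (cvg_fmap2 idx).
Qed.

Lemma weakly_open_open (R : realType) (Z : normedModType R) (U : set Z) :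
  weakly_open U -> open U.
Proof.
move=> Uo; have /continuousP : continuous (id : Z -> weak_space Z).
  by apply: continuous_to_weak => phi; exact: (svalP phi).
by move=> /(_ _ Uo).
Qed.

(** Affine continuous maps are weak-to-weak continuous, because composing them
    with a continuous functional gives, up to a constant, a continuous
    functional. *)
Lemma weakly_open_affine (R : realType) (X Z : normedModType R)
    (T : {linear X -> Z}) (c : Z) (U : set Z) :
  continuous T -> weakly_open U -> weakly_open [set x | U (c + T x)].
Proof.
move=> Tc Uo.
suff /continuousP : continuous ((fun x => c + T x) :
    weak_space X -> weak_space Z) by move=> /(_ _ Uo).
apply: continuous_to_weak => -[phi phic] /=.
have cT : continuous ((phi \o T : {linear X -> R^o}) : X -> R^o).
  by move=> x; apply: continuous_comp; [exact: Tc|exact: phic].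
rewrite (_ : _ \o _ = fun x : weak_space X => phi c + (phi \o T) x); last first.
  by apply/funext => x /=; rewrite raddfD.
move=> x; apply: (@cvgD _ R^o _ (nbhs (x : weak_space X))); first exact: cvg_cst.
exact: (@dual_weak_continuous R X (exist _ (phi \o T : {linear X -> R^o}) cT)).
Qed.

(** Membership in the weak closure of [P], phrased through [weakly_open] so that
    the points keep the type [Z] and its vector space structure. *)
Definition weakly_adherent (R : realType) (Z : normedModType R) (P : set Z)
    (z : Z) :=
  forall U : set Z, weakly_open U -> U z -> P `&` U !=set0.

Lemma weakly_adherent_linear (R : realType) (X Z : normedModType R)
    (T : {linear X -> Z}) (P : set X) (x : X) :
  continuous T -> weakly_adherent P x -> weakly_adherent (T @` P) (T x).
Proof.
move=> Tc Px U Uo UTx.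
have [||y [Py /=]] := Px [set y | U (0 + T y)]; rewrite ?add0r.
- exact: weakly_open_affine.
- by rewrite /= add0r.
- by exists (T y); split=> //; exists y.
Qed.

(** Addition is weakly continuous; here both summands are moved one after the
    other, each time along an affine map, so that only weak continuity of
    translations is used. *)
Lemma weakly_adherentD (R : realType) (Z : normedModType R) (P Q : set Z)
    (x y : Z) :
  weakly_adherent P x -> weakly_adherent Q y ->
  weakly_adherent [set p + q | p in P & q in Q] (x + y).
Proof.
move=> Px Qy U Uo Uxy.
have idc : continuous (idfun : {linear Z -> Z}) by move=> ?.
have [|p [Pp /= Upy]] := Px _ (weakly_open_affine y idc Uo).
  by rewrite /= addrC.
have [|q [Qq /= Upq]] := Qy _ (weakly_open_affine p idc Uo).
  by rewrite /= addrC.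
by exists (p + q); split=> //; exists p => //; exists q.
Qed.

Lemma weakly_adherent_sum (R : realType) (Z : normedModType R) n
    (P : 'I_n -> set Z) (z : 'I_n -> Z) :
  (forall i, weakly_adherent (P i) (z i)) ->
  weakly_adherent [set \sum_i y i | y in [set y | forall i, P i (y i)]]
    (\sum_i z i).
Proof.
elim: n => [|n IH] in P z * => Pz.
  by move=> U _ Uz; exists (\sum_(i < 0) z i); split=> //; exists z => // -[].
rewrite big_ord_recl => U Uo Uz.
have Pz' := IH _ _ (fun i => Pz (lift ord0 i)).
have [_ [[p Pp [_ [q Pq <-] <-]] Upq]] :=
  weakly_adherentD (Pz ord0) Pz' Uo Uz.
exists (p + \sum_i q i); split=> //.
exists (fun i => if unlift ord0 i is Some j then q j else p).
  by move=> i /=; case: unliftP => [j|] ->.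
rewrite big_ord_recl unlift_none; congr (_ + _).
by apply: eq_bigr => i _; rewrite liftK.
Qed.

(** * Diametral points *)

Definition diametral (R : realType) (Z : normedModType R) : set Z :=
  [set z | `|z| <= 1 /\ forall e : R, 0 < e ->
    weakly_adherent (unit_ball Z `&` [set y | 2 - e < `|z - y|]) z].

Lemma norm_diametral (R : realType) (Z : normedModType R) (z : Z) :
  diametral z -> `|z| = 1.
Proof.
move=> [z1 zadh]; apply/eqP; rewrite eq_le z1/=.
apply/ler_addgt0Pr => e e0.
have [y [[/= y1 zy] _]] := zadh e e0 setT openT I.
have := ler_normB z y.
by move: zy y1; rewrite /unit_ball/=; lra.
Qed.

Lemma ball_dist_le2 (R : realType) (Z : normedModType R) (z y : Z) :
  unit_ball Z z -> unit_ball Z y -> `|z - y| <= 2.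
Proof.
rewrite /unit_ball/= => z1 y1; apply: le_trans (ler_normB _ _) _.
by move: z1 y1; lra.
Qed.

(** The supremum of the distances to the points of [V] equals 2 as soon as these
    distances come arbitrarily close to 2, since no two points of the ball are
    further apart. *)
Lemma weakDD2PP (R : realType) (Z : normedModType R) :
  weakDD2P Z <-> unit_ball Z `<=` weakly_adherent (@diametral R Z).
Proof.
split=> [ZD x x1 U Uo Ux|ZD _ [U Uo ->] [w [Uw w1]]].
- have [||z [Uz z1] zsup] := ZD (U `&` unit_ball Z); first by exists U.
    by exists x.
  exists z; split=> //; split=> // e e0 V Vo Vz.
  pose dists := [set `|z - y| | y in V `&` unit_ball Z].
  have dsup : has_sup dists.
    split; first by exists `|z - z|, z.
    by exists 2 => _ [y [_ y1] <-]; exact: ball_dist_le2.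
  have [_ [y [Vy y1] <-]] := sup_adherent e0 dsup.
  by rewrite /dists zsup//; [exists y|exists V].
- have [z [[z1 zadh] Uz]] := ZD w w1 U Uo Uw.
  exists z => // _ [V Vo ->] [Vz _].
  have ub2 : ubound [set `|z - y| | y in V `&` unit_ball Z] 2.
    by move=> _ [y [_ y1] <-]; exact: ball_dist_le2.
  apply/eqP; rewrite eq_le; apply/andP; split.
    by apply: ge_sup => //; exists `|z - z|, z.
  apply/ler_addgt0Pr => e e0.
  have [y [[y1 /= zy] Vy]] := zadh e e0 V Vo Vz.
  have : `|z - y| <= sup [set `|z - y| | y in V `&` unit_ball Z].
    by apply: ub_le_sup; [exists 2|exists y].
  by move: zy; lra.
Qed.

(** * Transfer of the weak-DD2P through monotone families *)

(** For [T i x := \1_(A i) *: x] with disjoint sets [A i], this is the lattice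
    property of the norm of a Koethe-Bochner space. *)
Definition monotone_family (R : realType) (X Z : normedModType R) n
    (T : 'I_n -> {linear X -> Z}) :=
  forall x y : 'I_n -> X, (forall i, `|x i| <= `|y i|) ->
    `|\sum_i T i (x i)| <= `|\sum_i T i (y i)|.

Lemma monotone_familyE (R : realType) (X Z : normedModType R) n
    (T : 'I_n -> {linear X -> Z}) (x y : 'I_n -> X) :
  monotone_family T -> (forall i, `|x i| = `|y i|) ->
  `|\sum_i T i (x i)| = `|\sum_i T i (y i)|.
Proof.
by move=> mT xy; apply/eqP; rewrite eq_le !mT// => i; rewrite xy.
Qed.

(** The coordinates of [\sum_i T i (r i *: x i)] can be approximated weakly and
    independently of each other, while the sum stays in a weak neighbourhood.
    This yields both the diametral point and the points almost opposite to it. *)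
Lemma weakly_adherent_family (R : realType) (X Z : normedModType R) n
    (T : 'I_n -> {linear X -> Z}) (P : 'I_n -> set X) (r : 'I_n -> R)
    (x : 'I_n -> X) (U : set Z) :
  (forall i, continuous (T i)) ->
  (forall i, weakly_adherent (P i) (x i)) ->
  weakly_open U -> U (\sum_i T i (r i *: x i)) ->
  exists2 y : 'I_n -> X, forall i, P i (y i) & U (\sum_i T i (r i *: y i)).
Proof.
move=> Tc Px Uo Ux.
pose rT i : {linear X -> Z} := r i \*: T i.
have rTc i : continuous (rT i).
  by move=> t; apply: cvgZ; [exact: cvg_cst|exact: Tc].
have [|_ [[u Pu <-] Uu]] := weakly_adherent_sum
  (fun i => weakly_adherent_linear (rTc i) (Px i)) Uo _.
  by under eq_bigr do rewrite /= -linearZ.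
have /choice[y Py] i : exists y, P i y /\ rT i y = u i.
  by have [y] := Pu i; exists y.
exists y; first by move=> i; case: (Py i).
suff -> : \sum_i T i (r i *: y i) = \sum_i u i by [].
by apply: eq_bigr => i _; case: (Py i) => _ <-; rewrite linearZ.
Qed.

(** The nonzero vectors of norm less than 1 in [U] form a norm-open set, so it is
    enough to find one of them, near [w]: shrink [w] a little, or, if [w] is
    0, take a small multiple of [g]. *)
Lemma dense_weakly_open (R : realType) (Z : normedModType R) (D U : set Z)
    (w g : Z) :
  dense D -> weakly_open U -> U w -> `|w| <= 1 -> g != 0 ->
  exists f, [/\ D f, U f & 0 < `|f| <= 1].
Proof.
move=> Dd /weakly_open_open Uo Uw w1 g0.
pose v := if w == 0 then g else - w.
have v0 : v != 0 by rewrite /v; case: (eqVneq w 0); rewrite ?oppr_eq0.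
have nv0 : 0 < `|v| by rewrite normr_gt0.
have sV0 : \forall s \near 0^'+, U (w + s *: v).
  apply: (@cvg_at_right_filter _ _ (fun s : R => w + s *: v) 0 w).
    rewrite -[X in _ --> X](_ : w + 0 *: v = w); last first.
      by rewrite scale0r addr0.
    apply: cvgD; first exact: cvg_cst.
    by apply: cvgZ; [exact: cvg_id|exact: cvg_cst].
  exact: open_nbhs_nbhs.
have inv_gt0 : 0 < (1 + `|v|)^-1 by rewrite invr_gt0 ltr_pwDl.
have [s [s0 sv Us]] : exists s : R,
    [/\ 0 < s, s < (1 + `|v|)^-1 & U (w + s *: v)].
  near (0 : R)^'+ => s; exists s; split; near: s => //.
  - exact: nbhs_right_gt.
  - exact: nbhs_right_lt.
have {}sv : s * (1 + `|v|) < 1 by rewrite -ltr_pdivlMr ?div1r// ltr_pwDl.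
have s1 : s < 1 by apply: le_lt_trans sv; rewrite ler_peMr ?ltW// ltrDl.
have [wsv1 wsv0] : `|w + s *: v| < 1 /\ w + s *: v != 0.
  have [w0|w0] := eqVneq w 0.
    rewrite w0 add0r scaler_eq0 negb_or v0 gt_eqF//; split=> //.
    rewrite normrZ gtr0_norm//; apply: le_lt_trans sv.
    by rewrite ler_wpM2l ?ltW// ltrDr.
  have s1' : 0 < 1 - s by rewrite subr_gt0.
  have -> : w + s *: v = (1 - s) *: w.
    by rewrite /v (negbTE w0) scalerBl scale1r scalerN.
  rewrite normrZ gtr0_norm// scaler_eq0 negb_or w0 gt_eqF//; split=> //.
  apply: (@le_lt_trans _ _ (1 - s)); first by rewrite ler_piMr// ltW.
  by rewrite ltrBlDr ltrDl.
have [||f [[[Uf /= f1] f0] Df]] :=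
    Dd (U `&` [set f | `|f| < 1] `&` [set f | 0 < `|f|]).
- by exists (w + s *: v); rewrite /= normr_gt0.
- apply: openI; first apply: openI => //.
    by move/continuousP : (@norm_continuous R Z) => /(_ _ (@open_lt _ 1)).
  by move/continuousP : (@norm_continuous R Z) => /(_ _ (@open_gt _ 0)).
- by exists f; split=> //; rewrite f0 ltW.
Unshelve. all: by end_near. Qed.

(** The weights [r i] are chosen so that replacing [x i] by [r i] times a unit
    vector multiplies the norm of the sum by exactly [`|f|^-1]. *)
Theorem weakDD2P_dense_monotone (R : realType) (X Z : normedModType R)
    (D : set Z) (g : Z) :
  g != 0 -> dense D ->
  (forall f, D f -> exists n (T : 'I_n -> {linear X -> Z}) (x : 'I_n -> X),
    [/\ forall i, continuous (T i), monotone_family T & f = \sum_i T i (x i)]) ->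
  weakDD2P X -> weakDD2P Z.
Proof.
move=> g0 Dd DT /weakDD2PP XD; apply/weakDD2PP => w w1 U Uo Uw.
have [f [Df Uf /andP[f0 f1]]] := dense_weakly_open Dd Uo Uw w1 g0.
have [n [T [x [Tc mT fE]]]] := DT f Df.
pose r i : R := `|x i| / `|f|.
have r0 i : 0 <= r i by rewrite divr_ge0.
(* If [x i] is 0 then so are [r i] and [u i], the inverse of 0 being 0. *)
pose u i := (r i)^-1 *: x i.
have ru i : r i *: u i = x i.
  rewrite scalerA; have [->|xi0] := eqVneq (x i) 0; first by rewrite scaler0.
  by rewrite mulfV ?scale1r// mulf_neq0 ?invr_neq0 ?normr_eq0 ?gt_eqF// -normr_gt0.
have uadh i : weakly_adherent (@diametral R X) (u i).
  apply: XD; rewrite /unit_ball/= normrZ ger0_norm ?invr_ge0// invf_div.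
  have [->|xi0] := eqVneq (x i) 0; first by rewrite normr0 mulr0.
  by rewrite divfK// normr_eq0.
have [|z zdiam Uz] := weakly_adherent_family (r := r) Tc uadh Uo.
  by under eq_bigr do rewrite ru; rewrite -fE.
pose F (y : 'I_n -> X) := \sum_i T i (r i *: y i).
have FB y y' : F y - F y' = F (fun i => y i - y' i).
  by rewrite -sumrB; apply: eq_bigr => i _; rewrite scalerBr linearB.
have FZ c y : F (fun i => c *: y i) = c *: F y.
  rewrite scaler_sumr; apply: eq_bigr => i _.
  by rewrite scalerA mulrC -scalerA linearZ.
have Fmono y y' : (forall i, `|y i| <= `|y' i|) -> `|F y| <= `|F y'|.
  by move=> yy'; apply: mT => i; rewrite !normrZ ler_wpM2l.
have Fz1 : `|F z| = 1.
  rewrite (@monotone_familyE _ _ _ _ T _ (fun i => `|f|^-1 *: x i) mT).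
    under eq_bigr do rewrite linearZ.
    by rewrite -scaler_sumr -fE normrZ normfV normr_id mulVf// gt_eqF.
  move=> i; rewrite !normrZ (norm_diametral (zdiam i)) mulr1 normfV normr_id.
  by rewrite ger0_norm// mulrC.
exists (F z); split=> //; split; first by rewrite Fz1.
move=> e e0 V Vo Vz.
have e20 : 0 < e / 2 by rewrite divr_gt0.
have [y yz Vy] := weakly_adherent_family (r := r) Tc
  (fun i => (zdiam i).2 _ e20) Vo Vz.
exists (F y); split=> //; split.
  rewrite /unit_ball/= -Fz1; apply: Fmono => i.
  by rewrite (norm_diametral (zdiam i)); case: (yz i).
(* The slack [e / 2] turns strict bounds on the coordinates into a strict bound
   on the sum.  For [e >= 4] the factor [2 - e / 2] cannot be taken out of the
   norm, but the bound to prove is then negative. *)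
rewrite /=; have [e2|e2] := leP (2 - e / 2) 0.
  by apply: lt_le_trans (normr_ge0 _); move: e0 e2; lra.
apply: (@lt_le_trans _ _ (2 - e / 2)); first by move: e0; lra.
have <- : `|F (fun i => (2 - e / 2) *: z i)| = 2 - e / 2.
  by rewrite FZ normrZ Fz1 mulr1 gtr0_norm.
rewrite FB.
apply: Fmono => i; rewrite normrZ (norm_diametral (zdiam i)) mulr1 gtr0_norm//.
by case: (yz i) => _ /ltW.
Qed.

(** * Simple functions with values in a normed space *)

Section indicator_embedding.
Context d (S : measurableType d) (R : realType).
Context (mu : {measure set S -> \bar R}) (cmu : measure_is_complete mu).
Context (smu : sigma_finite [set: S] mu).
Variables (E : kothe_space cmu smu) (X : normedModType R).

Section one_set.
Variables (A : set S) (mA : measurable A) (fA : (mu A < +oo)%E).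

Lemma norm_indicZ (x : X) :
  (fun t => `|(\1_A t : R) *: x|) = `|x| *: (\1_A : S -> R).
Proof.
by apply/funext => t; rewrite normrZ mulrC ger0_norm.
Qed.

Lemma indicZ_kb (x : X) :
  (fun t => (\1_A t : R) *: x) \in @kb_pred _ _ _ _ _ _ E X.
Proof.
apply/mem_set; split; last first.
  by rewrite norm_indicZ; apply: kothe_memZ; exact: kothe_indic.
exists (fun _ t => \1_A t *: x); last first.
  by apply: aeW => t; under eq_fun do rewrite subrr normr0; exact: cvg_cst.
move=> _; exists 1%N, (fun=> A); split=> //.
- by move=> i j _ _ _; rewrite !ord1.
- by move=> _; exists x => t At; rewrite indicE mem_set// scale1r.
- move=> t At; rewrite indicE memNset ?scale0r// => At'; apply: At.
  by exists ord0.
Qed.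

Definition indic_fun (x : X) : kb_fun E X :=
  exist (fun f => f \in @kb_pred _ _ _ _ _ _ E X) _ (indicZ_kb x).

Definition indic_embed (x : X) : kothe_bochner E X := kb_class (indic_fun x).

Lemma indic_embed_is_linear : linear indic_embed.
Proof.
move=> a x y; rewrite -[a *: indic_embed x]kb_classZ -kb_classD; congr kb_class.
apply/val_inj/funext => t; rewrite /= -[RHS]/(a *: (\1_A t *: x) + \1_A t *: y).
by rewrite scalerDr !scalerA mulrC.
Qed.

HB.instance Definition _ := GRing.isLinear.Build R X (kothe_bochner E X) _
  indic_embed indic_embed_is_linear.

Lemma norm_indic_embed (x : X) :
  `|indic_embed x| = `|x| * kothe_norm E (\1_A : S -> R).
Proof.
rewrite -[LHS]/(kb_norm (indic_embed x)) kb_norm_class/= norm_indicZ.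
by rewrite kothe_normZ ?normr_id//; exact: kothe_indic.
Qed.

Lemma indic_embed_continuous : continuous indic_embed.
Proof.
apply: bounded_linear_continuous; apply/linear_boundedP.
exists (kothe_norm E (\1_A : S -> R)); split=> [|r /ltW r_ge x].
  exact: num_real.
by rewrite norm_indic_embed mulrC ler_wpM2r.
Qed.

(** Since elements of [E(X)] are classes, the set [A] must not be null. *)
Lemma indic_embed_neq0 (x : X) : (0 < mu A)%E -> x != 0 -> indic_embed x != 0.
Proof.
move=> A0 x0; apply/eqP; rewrite -kb_class0 => /kb_classP[N [mN N0 sN]].
have : (mu A <= mu N)%E.
  apply: le_measure; rewrite ?inE// => t At; apply: sN => /= /(_ I) /eqP.
  by rewrite /= indicE mem_set// scale1r => /eqP x0'; rewrite x0' eqxx in x0.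
by rewrite N0 leNgt A0.
Qed.

End one_set.

Section disjoint_sets.
Variables (n : nat) (A : 'I_n -> set S).
Hypothesis mA : forall i, measurable (A i).
Hypothesis fA : forall i, (mu (A i) < +oo)%E.

Let T i : {linear X -> kothe_bochner E X} := indic_embed (mA i) (fA i).

Lemma sum_indic_embed (x : 'I_n -> X) :
  \sum_i T i (x i) = kb_class (\sum_i indic_fun (mA i) (fA i) (x i)).
Proof.
by rewrite (big_morph _ (@kb_classD _ _ _ _ _ _ E X) (kb_class0 E X)).
Qed.

Lemma sum_indic_fun (x : 'I_n -> X) t :
  val (\sum_i indic_fun (mA i) (fA i) (x i)) t = \sum_i (\1_(A i) t : R) *: x i.
Proof. by rewrite (raddf_sum val) fct_sumE. Qed.

Hypothesis tA : trivIset setT A.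

Lemma sum_indic_in (x : 'I_n -> X) i t :
  A i t -> \sum_j (\1_(A j) t : R) *: x j = x i.
Proof.
move=> At; rewrite (bigD1 i)//= indicE mem_set// scale1r big1 ?addr0// => j ji.
rewrite indicE memNset ?scale0r// => Ajt.
by move/eqP: ji; apply; apply: tA => //; exists t.
Qed.

Lemma sum_indic_out (x : 'I_n -> X) t :
  ~ (\bigcup_i A i) t -> \sum_j (\1_(A j) t : R) *: x j = 0.
Proof.
move=> At; rewrite big1// => j _; rewrite indicE memNset ?scale0r// => Ajt.
by apply: At; exists j.
Qed.

(** At each point at most one of the disjoint sets contributes, so the pointwise
    norm of the sum is one of the [`|x i|] or 0; the ideal property of [E] then
    compares the norms. *)
Lemma indic_embed_monotone : monotone_family T.
Proof.
move=> x y xy; rewrite !sum_indic_embed.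
rewrite -![`|kb_class _|]/(kb_norm (kb_class _)) !kb_norm_class.
apply: (kothe_ideal (kb_fun_mem _) _ _).2.
  exact: kothe_measurable (kb_fun_mem _).
apply: aeW => t; rewrite !normr_id !sum_indic_fun.
have [[i _ At]|At] := pselect ((\bigcup_i A i) t).
  by rewrite !(sum_indic_in _ At).
by rewrite !sum_indic_out.
Qed.

End disjoint_sets.

Lemma kb_simple_monotone (f : kothe_bochner E X) : kb_simple E X f ->
  exists n (T : 'I_n -> {linear X -> kothe_bochner E X}) (x : 'I_n -> X),
    [/\ forall i, continuous (T i), monotone_family T & f = \sum_i T i (x i)].
Proof.
move=> [{}f [n [A [/all_and2[mA fA] tA /choice[c fc] f0]]] ->].
exists n, (fun i => indic_embed (mA i) (fA i)), c; split.
- by move=> i; exact: indic_embed_continuous.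
- exact: indic_embed_monotone.
- rewrite sum_indic_embed; apply/kb_classP; apply: aeW => t _.
  rewrite sum_indic_fun.
  have [[i _ At]|At] := pselect ((\bigcup_i A i) t).
    by rewrite (sum_indic_in tA _ At) (fc i).
  by rewrite sum_indic_out// f0.
Qed.

End indicator_embedding.

Lemma sigma_finite_pos_set d (S : measurableType d) (R : realType)
    (mu : {measure set S -> \bar R}) :
  sigma_finite [set: S] mu -> (0 < mu [set: S])%E ->
  exists A, [/\ measurable A, (mu A < +oo)%E & (0 < mu A)%E].
Proof.
move=> [F FT mF] mu0; apply: contrapT => nA.
have F0 i : mu.-negligible (F i).
  have [mFi fFi] := mF i; apply/negligibleP => //; apply/eqP.
  rewrite eq_le measure_ge0 andbT leNgt; apply/negP => Fi.
  by apply: nA; exists (F i).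
have ST0 : mu.-negligible [set: S] by rewrite FT; exact: negligible_bigcup.
by move: mu0; rewrite (measure_negligible measurableT ST0) ltxx.
Qed.

(** * Koethe-Bochner spaces *)

Theorem theorem3p7 (d : measure_display) (S : measurableType d) (R : realType)
    (mu : {measure set S -> \bar R}) (cmu : measure_is_complete mu)
    (smu : sigma_finite [set: S] mu) (mu_gt0 : (0 < mu [set: S])%E)
    (E : kothe_space cmu smu) (X : completeNormedModType R)
    (dense_simple : dense (kb_simple E X)) :
  weakDD2P X -> weakDD2P (kothe_bochner E X).
Proof.
move=> XD; have [A [mA fA A0]] := sigma_finite_pos_set smu mu_gt0.
(* A nonzero vector of [X]: any diametral point, for instance near 0. *)
have [z [zdiam _]] : @diametral R X `&` setT !=set0.
  by move/weakDD2PP : XD => /(_ 0 _ setT openT I); apply;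
    rewrite /unit_ball/= normr0.
have z0 : z != 0 by rewrite -normr_gt0 norm_diametral.
exact: (weakDD2P_dense_monotone (indic_embed_neq0 E mA fA A0 z0) dense_simple
  (@kb_simple_monotone _ _ _ _ _ _ E X)).
Qed.
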